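(* Let $(X,\Sigma,\lambda)$ be a positive measure space. An element $f\in L_\infty(X)$ is right-symmetric if and only if $|f(x)|=\|f\|_\infty$ for almost every $x\in X$.
   Context: $\mathbb{K}$ is $\mathbb{R}$ or $\mathbb{C}$. $L_\infty(X)=L_\infty^{\mathbb{K}}(X,\Sigma,\lambda)$ is the space of essentially bounded measurable $\mathbb{K}$-valued functions (modulo a.e. equality) with the essential supremum norm $\|\cdot\|_\infty$; the measure is arbitrary (no finiteness or $\sigma$-finiteness is assumed). In a normed space $\mathbb{X}$ over $\mathbb{K}$, $x\perp_B y$ (Birkhoff-James orthogonality) means $\|x+\alpha y\|\ge\|x\|$ for all $\alpha\in\mathbb{K}$; $x\in\mathbb{X}$ is right-symmetric if $y\perp_B x$ implies $x\perp_B y$ for every $y\in\mathbb{X}$. *)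

(* Defs.v *)
From HB Require Import structures.
From mathcomp Require Import all_boot all_order all_algebra.
From mathcomp Require Import all_classical all_reals all_analysis.
From mathcomp Require Import ess_sup_inf complex.

Set Implicit Arguments.
Unset Strict Implicit.
Unset Printing Implicit Defensive.

Import Order.TTheory GRing.Theory Num.Theory.
Import numFieldNormedType.Exports.

Local Open Scope classical_set_scope.
Local Open Scope ring_scope.

Section birkhoff_james.
Context (K : numFieldType) (V : normedModType K).
Implicit Types x y : V.

Definition BJ_orthogonal x y := forall a : K, `|x| <= `|x + a *: y|.

Definition right_symmetric x :=
  forall y, BJ_orthogonal y x -> BJ_orthogonal x y.

End birkhoff_james.

Variant scalar_kind := RealScalars | ComplexScalars.

Section scalars.
Context (R : realType).

Definition scalars (k : scalar_kind) : numFieldType :=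
  match k with RealScalars => R | ComplexScalars => R[i] end.

Definition real_scalar (k : scalar_kind) : R -> scalars k :=
  match k return R -> scalars k with
  | RealScalars => id
  | ComplexScalars => fun r => r%:C%C
  end.

(* The norm of a numFieldType is valued in the field itself; this is the same
   norm with values in R (see modulusE), as needed by ess_sup and Lnorm. *)
Definition modulus (k : scalar_kind) : scalars k -> R :=
  match k return scalars k -> R with
  | RealScalars => fun z => `|z|
  | ComplexScalars => fun z => complex.Re `|z|
  end.

(* For RealScalars, measurability into borel_scalars is the library's
   measurability into R (open_measurable, RGenOpens.measurableE). *)
Definition borel_scalars (k : scalar_kind) :=
  g_sigma_algebraType (@open (scalars k)).

Context (k : scalar_kind).
Implicit Types (z w : scalars k) (r : R).

Lemma modulusE z : real_scalar k (modulus z) = `|z|.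
Proof. by case: k z => //= -[a b]. Qed.

Lemma ler_real_scalar r s : (real_scalar k r <= real_scalar k s) = (r <= s).
Proof. by case: k => //=; rewrite lecR. Qed.

Lemma real_scalarD r s :
  real_scalar k (r + s) = real_scalar k r + real_scalar k s.
Proof. by case: k => //=; rewrite rmorphD. Qed.

Lemma real_scalarM r s :
  real_scalar k (r * s) = real_scalar k r * real_scalar k s.
Proof. by case: k => //=; rewrite rmorphM. Qed.

Lemma real_scalar0 : real_scalar k 0 = 0.
Proof. by case: k. Qed.

Lemma real_scalar_inj : injective (real_scalar k).
Proof. by case: k => //= r s []. Qed.

Lemma modulus_ge0 z : 0 <= modulus z.
Proof. by rewrite -ler_real_scalar modulusE real_scalar0. Qed.

Lemma modulusD z w : modulus (z + w) <= modulus z + modulus w.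
Proof. by rewrite -ler_real_scalar real_scalarD !modulusE ler_normD. Qed.

Lemma modulusM z w : modulus (z * w) = modulus z * modulus w.
Proof. by apply: real_scalar_inj; rewrite real_scalarM !modulusE normrM. Qed.

Lemma modulus0 : modulus (0 : scalars k) = 0.
Proof. by apply: real_scalar_inj; rewrite modulusE normr0 real_scalar0. Qed.

Lemma modulus_eq0 z : modulus z = 0 -> z = 0.
Proof. by move=> z0; apply/normr0_eq0; rewrite -modulusE z0 real_scalar0. Qed.

Definition rational_scalar (q : rat * rat) : scalars k :=
  match k return scalars k with
  | RealScalars => ratr q.1
  | ComplexScalars => (ratr q.1 +i* ratr q.2)%C
  end.

Let dense_rat (x e : R) : 0 < e -> exists q : rat, `|x - ratr q| < e.
Proof.
move=> e0; have : x - e < x + e by rewrite ltrBlDr -addrA ltrDl addr_gt0.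
move=> /rat_in_itvoo[q]; rewrite in_itv/= => /andP[q1 q2]; exists q.
by rewrite ltr_distlC q1.
Qed.

Lemma dense_rational_scalar z r : 0 < r ->
  exists q, `|z - rational_scalar q| < real_scalar k r.
Proof.
rewrite /rational_scalar; case: k z => /= z r0.
  by have [q zq] := dense_rat z r0; exists (q, q).
case: z => a b; have r20 : 0 < r / 2 by rewrite divr_gt0.
have [p ap] := dense_rat a r20; have [q bq] := dense_rat b r20.
exists (p, q) => /=; rewrite [X in `|X|](_ : _ =
    (a - ratr p)%:C%C + 'i%C * (b - ratr q)%:C%C); last by simpc.
apply: le_lt_trans (ler_normD _ _) _; rewrite normrM.
have -> : `|'i%C : R[i]| = 1 by simpc; rewrite /= expr0n expr1n add0r sqrtr1.
have nC (c : R) : `|c%:C%C| = `|c|%:C%C.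
  by simpc; rewrite /= expr0n addr0 sqrtr_sqr.
by rewrite mul1r !nC -rmorphD ltcR [ltRHS](splitr r) ltrD.
Qed.

Lemma real_scalar_arch (e : scalars k) : 0 < e ->
  exists n : nat, real_scalar k n.+1%:R^-1 < e.
Proof.
have arch (r : R) : 0 < r -> exists n : nat, n.+1%:R^-1 < r.
  by move=> /ltr_add_invr[n]; rewrite add0r => ?; exists n.
case: k e => /= [|[a b]]; first exact: arch.
rewrite ltcE/= => /andP[/eqP-> /arch[n na]]; exists n.
by rewrite ltcE/= eqxx.
Qed.

End scalars.

Arguments real_scalar {R} k.
Arguments modulus {R k}.

Section measurable_scalars.
Context (R : realType) (k : scalar_kind) d (X : measurableType d).
Implicit Types f g : X -> scalars R k.

Local Notation measurable_scalar f :=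
  (measurable_fun [set: X] ((f : X -> scalars R k) : X -> borel_scalars R k)).

Lemma measurable_scalarP f : measurable_scalar f <->
  forall U, open U -> measurable (f @^-1` U).
Proof.
split=> [mf U oU|mf].
  by rewrite -[_ @^-1` _]setTI; apply: mf => //; exact: sub_sigma_algebra.
apply: (@measurability _ _ _ (borel_scalars R k) _ _ open) => // _ [U oU <-].
by rewrite setTI; exact: mf.
Qed.

Lemma measurable_scalar_cst z : measurable_scalar (fun=> z).
Proof. exact: measurable_cst. Qed.

Lemma measurable_scalarM z f :
  measurable_scalar f -> measurable_scalar (fun x => z * f x).
Proof.
move=> /measurable_scalarP mf; apply/measurable_scalarP => U oU.
apply: (mf ((fun w => z * w) @^-1` U)); apply: open_comp => // w _.
exact: mulrl_continuous.
Qed.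

Lemma measurable_scalarD f g :
  measurable_scalar f -> measurable_scalar g ->
  measurable_scalar (fun x => f x + g x).
Proof.
move=> /measurable_scalarP mf /measurable_scalarP mg.
apply/measurable_scalarP => U oU.
pose q p : scalars R k := rational_scalar R k p.
pose s n : scalars R k := real_scalar k n.+1%:R^-1.
have sgt0 n : 0 < s n.
  rewrite lt0r /s -real_scalar0 ler_real_scalar invr_ge0 ler0n andbT.
  by apply/negP => /eqP/real_scalar_inj/eqP; rewrite invr_eq0 pnatr_eq0.
pose F (i : (rat * rat) * (rat * rat) * nat) : set X :=
  let: (p1, p2, n) := i in
  [set x | ball (q p1 + q p2) (s n + s n) `<=` U] `&`
  ((f @^-1` ball (q p1) (s n)) `&` (g @^-1` ball (q p2) (s n))).
rewrite (_ : _ @^-1` U = \bigcup_i F i).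
  apply: countable_bigcupT_measurable => // -[[p1 p2] n].
  apply: measurableI.
    have [H|H] := pselect (ball (q p1 + q p2) (s n + s n) `<=` U).
      by rewrite (_ : [set _ | _] = setT) //; apply/seteqP; split.
    by rewrite (_ : [set _ | _] = set0) //; apply/seteqP; split.
  by apply: measurableI; [apply: mf|apply: mg]; exact: ball_open.
apply/seteqP; split=> [x /= Ux|x [[[p1 p2] n] _] /= [sU [/= fx gx]]]; last first.
  apply: sU; move: fx gx; rewrite -!ball_normE /= => fx gx.
  by rewrite opprD addrACA (le_lt_trans (ler_normD _ _))// ltrD.
have [e /= e0 eU] : exists2 e : scalars R k, 0 < e & ball (f x + g x) e `<=` U.
  by have := open_nbhs_nbhs (conj oU Ux); rewrite -nbhs_ballE.
have [n ne] := real_scalar_arch (divr_gt0 (divr_gt0 e0 (ltr0n _ 2)) (ltr0n _ 2)).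
have n0 : 0 < n.+1%:R^-1 :> R by rewrite invr_gt0.
have [p1 fp1] := dense_rational_scalar (f x) n0.
have [p2 gp2] := dense_rational_scalar (g x) n0.
exists (p1, p2, n) => //=; rewrite -!ball_normE /=.
split; last by rewrite ![`|q _ - _|]distrC.
move=> w /= wb; apply: eU; rewrite -ball_normE /=.
rewrite -(subrKA (q p1 + q p2)) (le_lt_trans (ler_normD _ _))//.
rewrite opprD addrACA.
rewrite (splitr e) (splitr (e / 2)).
rewrite ltrD//.
  by rewrite (le_lt_trans (ler_normD _ _))// ltrD// (lt_trans _ ne).
by rewrite (lt_trans wb)// ltrD.
Qed.

End measurable_scalars.

Section Lzero.
Context (R : realType) (k : scalar_kind) d (X : measurableType d)
  (mu : {measure set X -> \bar R}).
Local Open Scope quotient_scope.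

(* Measurable scalar functions modulo mu-a.e. equality; the coercion Lzero_fun
   picks a representative, so f x is only meaningful up to a null set. *)
Definition Lzero : Type := {mfun_ mu, X >-> borel_scalars R k}.
HB.instance Definition _ := Choice.on Lzero.

Definition Lzero_fun (f : Lzero) : X -> scalars R k := repr f.
Coercion Lzero_fun : Lzero >-> Funclass.

Lemma measurable_Lzero (f : Lzero) :
  measurable_fun [set: X] (f : X -> borel_scalars R k).
Proof. exact: (@measurable_funPT _ _ _ _ (repr f)). Qed.

Definition Lzero_class (f : X -> scalars R k)
    (mf : measurable_fun [set: X] (f : X -> borel_scalars R k)) : Lzero :=
  \pi_{mfun_ mu, X >-> borel_scalars R k} (mfun_Sub (mem_set mf)).

Lemma Lzero_classE f mf : \forall x \ae mu, @Lzero_class f mf x = f x.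
Proof.
have /eqquotP/asboolP :
    \pi_{mfun_ mu, X >-> borel_scalars R k} (repr (Lzero_class mf)) =
    \pi_{mfun_ mu, X >-> borel_scalars R k} (mfun_Sub (mem_set mf)).
  by rewrite reprK.
by apply: filterS => x /(_ I).
Qed.

Lemma Lzero_ext (f g : Lzero) : (\forall x \ae mu, f x = g x) -> f = g.
Proof.
move=> fg; rewrite -[f]reprK -[g]reprK; apply/eqquotP/asboolP.
by apply: filterS fg => x.
Qed.

Definition Lzero0 := Lzero_class (@measurable_scalar_cst R k d X 0).
Definition Lzero_add (f g : Lzero) :=
  Lzero_class (measurable_scalarD (measurable_Lzero f) (measurable_Lzero g)).
Definition Lzero_scale (a : scalars R k) (f : Lzero) :=
  Lzero_class (measurable_scalarM a (measurable_Lzero f)).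
Definition Lzero_opp (f : Lzero) := Lzero_scale (- 1) f.

Let addE f g : \forall x \ae mu, Lzero_add f g x = f x + g x.
Proof. exact: Lzero_classE. Qed.
Let scaleE a f : \forall x \ae mu, Lzero_scale a f x = a * f x.
Proof. exact: Lzero_classE. Qed.
Let zeroE : \forall x \ae mu, Lzero0 x = 0.
Proof. exact: Lzero_classE. Qed.

Fact Lzero_addA : associative Lzero_add.
Proof.
move=> f g h; apply: Lzero_ext; near=> x.
rewrite (near (addE f (Lzero_add g h)) x)// (near (addE g h) x)//.
by rewrite (near (addE (Lzero_add f g) h) x)// (near (addE f g) x)// addrA.
Unshelve. all: by end_near. Qed.

Fact Lzero_addC : commutative Lzero_add.
Proof.
move=> f g; apply: Lzero_ext; near=> x.
by rewrite (near (addE f g) x)// (near (addE g f) x)// addrC.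
Unshelve. all: by end_near. Qed.

Fact Lzero_add0 : left_id Lzero0 Lzero_add.
Proof.
move=> f; apply: Lzero_ext; near=> x.
by rewrite (near (addE Lzero0 f) x)// (near zeroE x)// add0r.
Unshelve. all: by end_near. Qed.

Fact Lzero_addN : left_inverse Lzero0 Lzero_opp Lzero_add.
Proof.
move=> f; apply: Lzero_ext; near=> x.
rewrite (near (addE (Lzero_opp f) f) x)// (near zeroE x)//.
by rewrite (near (scaleE (- 1) f) x)// mulN1r addNr.
Unshelve. all: by end_near. Qed.

HB.instance Definition _ := GRing.isZmodule.Build Lzero
  Lzero_addA Lzero_addC Lzero_add0 Lzero_addN.

Fact Lzero_scaleA a b f :
  Lzero_scale a (Lzero_scale b f) = Lzero_scale (a * b) f.
Proof.
apply: Lzero_ext; near=> x.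
rewrite (near (scaleE a (Lzero_scale b f)) x)// (near (scaleE b f) x)//.
by rewrite (near (scaleE (a * b) f) x)// mulrA.
Unshelve. all: by end_near. Qed.

Fact Lzero_scale1 : left_id 1 Lzero_scale.
Proof.
move=> f; apply: Lzero_ext; near=> x.
by rewrite (near (scaleE 1 f) x)// mul1r.
Unshelve. all: by end_near. Qed.

Fact Lzero_scaleDr : right_distributive Lzero_scale +%R.
Proof.
move=> a f g; apply: Lzero_ext; near=> x.
rewrite (near (scaleE a (Lzero_add f g)) x)// (near (addE f g) x)//.
rewrite (near (addE (Lzero_scale a f) (Lzero_scale a g)) x)//.
by rewrite (near (scaleE a f) x)// (near (scaleE a g) x)// mulrDr.
Unshelve. all: by end_near. Qed.

Fact Lzero_scaleDl f : {morph Lzero_scale^~ f : a b / a + b}.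
Proof.
move=> a b; apply: Lzero_ext; near=> x.
rewrite (near (scaleE (a + b) f) x)//.
rewrite (near (addE (Lzero_scale a f) (Lzero_scale b f)) x)//.
by rewrite (near (scaleE a f) x)// (near (scaleE b f) x)// mulrDl.
Unshelve. all: by end_near. Qed.

HB.instance Definition _ := GRing.Zmodule_isLmodule.Build (scalars R k) Lzero
  Lzero_scaleA Lzero_scale1 Lzero_scaleDr Lzero_scaleDl.

Lemma LzeroD (f g : Lzero) : \forall x \ae mu, (f + g : Lzero) x = f x + g x.
Proof. exact: addE. Qed.

Lemma LzeroZ a (f : Lzero) : \forall x \ae mu, (a *: f : Lzero) x = a * f x.
Proof. exact: scaleE. Qed.

Lemma Lzero0E : \forall x \ae mu, (0 : Lzero) x = 0.
Proof. exact: zeroE. Qed.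

End Lzero.

Section Linfty.
Context (R : realType) (k : scalar_kind) d (X : measurableType d)
  (mu : {measure set X -> \bar R}).

Implicit Types (f g : Lzero k mu) (c : R) (a : scalars R k).

(* For the exponent +oo, Lnorm is the essential supremum of the modulus if
   mu X > 0, and 0 if mu X = 0 (where ess_sup would be -oo). *)
Definition ess_norm f : \bar R :=
  'N[mu]_+oo[EFin \o (modulus \o f)].

Lemma ess_norm_ge0 f : (0 <= ess_norm f)%E.
Proof. exact: Lnorm_ge0. Qed.

Lemma ess_norm_leP f c : 0 <= c ->
  (ess_norm f <= c%:E)%E <-> \forall x \ae mu, modulus (f x) <= c.
Proof.
move=> c0; rewrite /ess_norm unlock; case: ifPn => [muT|].
  split=> [/ess_supP|fc].
    by apply: filterS => x /=; rewrite lee_fin ger0_norm// modulus_ge0.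
  apply/ess_supP; apply: filterS fc => x /=.
  by rewrite lee_fin ger0_norm// modulus_ge0.
rewrite -leNgt measure_le0 lee_fin => /eqP muT; split=> // _.
by exists setT; split => //; exact: measurableT.
Qed.

Definition essentially_bounded : {pred Lzero k mu} :=
  fun f => (ess_norm f < +oo)%E.

Lemma ess_norm_fin f : f \in essentially_bounded ->
  (fine (ess_norm f))%:E = ess_norm f.
Proof. by move=> fb; rewrite fineK// ge0_fin_numE// ess_norm_ge0. Qed.

Lemma ae_le_ess_norm f : f \in essentially_bounded ->
  \forall x \ae mu, modulus (f x) <= fine (ess_norm f).
Proof.
move=> fb; apply/ess_norm_leP; first exact/fine_ge0/ess_norm_ge0.
by rewrite ess_norm_fin.
Qed.

Lemma ess_norm_le f c : 0 <= c -> (\forall x \ae mu, modulus (f x) <= c) ->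
  f \in essentially_bounded /\ fine (ess_norm f) <= c.
Proof.
move=> c0 /(ess_norm_leP _ c0) fc.
have fb : f \in essentially_bounded by exact: le_lt_trans fc (ltry _).
by rewrite fb -lee_fin ess_norm_fin.
Qed.

Lemma ess_normD f g : f \in essentially_bounded -> g \in essentially_bounded ->
  f + g \in essentially_bounded /\
  fine (ess_norm (f + g)) <= fine (ess_norm f) + fine (ess_norm g).
Proof.
move=> fb gb; apply: ess_norm_le.
  by rewrite addr_ge0// fine_ge0// ess_norm_ge0.
near=> x; rewrite (near (LzeroD f g) x)// (le_trans (modulusD _ _))// lerD//.
  by near: x; exact: ae_le_ess_norm.
by near: x; exact: ae_le_ess_norm.
Unshelve. all: by end_near. Qed.

Lemma ess_normZ_le a f : f \in essentially_bounded ->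
  a *: f \in essentially_bounded /\
  fine (ess_norm (a *: f)) <= modulus a * fine (ess_norm f).
Proof.
move=> fb; apply: ess_norm_le.
  by rewrite mulr_ge0 ?modulus_ge0 ?fine_ge0 ?ess_norm_ge0.
near=> x; rewrite (near (LzeroZ a f) x)// modulusM ler_wpM2l ?modulus_ge0//.
by near: x; exact: ae_le_ess_norm.
Unshelve. all: by end_near. Qed.

Lemma ess_norm0 : 0 \in essentially_bounded /\ fine (ess_norm 0) <= 0.
Proof.
apply: ess_norm_le => //; apply: filterS (Lzero0E k mu) => x ->.
by rewrite modulus0.
Qed.

Fact essentially_bounded_submod_closed : submod_closed essentially_bounded.
Proof.
split; first by case: ess_norm0.
move=> a f g fb gb; have [afb _] := ess_normZ_le a fb.
by have [] := ess_normD afb gb.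
Qed.

HB.instance Definition _ := GRing.isSubmodClosed.Build (scalars R k)
  (Lzero k mu) essentially_bounded essentially_bounded_submod_closed.

Record Linfty := MkLinfty {
  Linfty_val :> Lzero k mu;
  LinftyP : Linfty_val \in essentially_bounded }.

HB.instance Definition _ := [isSub for Linfty_val].
HB.instance Definition _ := [Choice of Linfty by <:].
HB.instance Definition _ := [SubChoice_isSubLmodule of Linfty by <:].

Definition Linfty_norm (f : Linfty) : scalars R k :=
  real_scalar k (fine (ess_norm f)).

Fact Linfty_normD (f g : Linfty) : Linfty_norm (f + g) <= Linfty_norm f + Linfty_norm g.
Proof.
rewrite /Linfty_norm -real_scalarD ler_real_scalar.
by case: (ess_normD (LinftyP f) (LinftyP g)).
Qed.

Fact Linfty_normZ a (f : Linfty) : Linfty_norm (a *: f) = `|a| * Linfty_norm f.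
Proof.
rewrite /Linfty_norm -modulusE -real_scalarM; congr real_scalar.
apply/eqP; rewrite eq_le; case: (ess_normZ_le a (LinftyP f)) => afb -> /=.
have [->|a0] := eqVneq a 0.
  by rewrite modulus0 mul0r fine_ge0// ess_norm_ge0.
have [_] := ess_normZ_le a^-1 afb.
rewrite scalerA mulVf// scale1r => /(ler_wpM2l (modulus_ge0 a))/le_trans; apply.
suff -> : modulus a * (modulus a^-1 * fine (ess_norm (a *: f : Lzero k mu))) =
    fine (ess_norm (a *: f : Lzero k mu)) by [].
rewrite mulrA -modulusM divff//.
have -> : modulus (1 : scalars R k) = 1.
  apply: (@real_scalar_inj R k); rewrite modulusE normr1.
  by case: (k).
by rewrite mul1r.
Qed.

Fact Linfty_norm0_eq0 (f : Linfty) : Linfty_norm f = 0 -> f = 0.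
Proof.
rewrite /Linfty_norm -(real_scalar0 R k) => /real_scalar_inj f0.
apply/val_inj/Lzero_ext; near=> x; rewrite (near (Lzero0E k mu) x)//.
apply/modulus_eq0/eqP; rewrite eq_le modulus_ge0 andbT -f0.
by near: x; exact: (ae_le_ess_norm (LinftyP f)).
Unshelve. all: by end_near. Qed.

HB.instance Definition _ := Lmodule_isNormed.Build (scalars R k) Linfty
  Linfty_normD Linfty_normZ Linfty_norm0_eq0.

End Linfty.

Arguments Linfty {R} k {d X} mu.

(* Main.v *)
Require Import Defs.
From mathcomp Require Import all_boot all_order all_algebra.
From mathcomp Require Import all_classical all_reals all_analysis.
From mathcomp Require Import complex ring lra.

Set Implicit Arguments.
Unset Strict Implicit.
Unset Printing Implicit Defensive.

Import Order.TTheory GRing.Theory Num.Theory.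
Import numFieldNormedType.Exports.
Local Open Scope classical_set_scope.
Local Open Scope ring_scope.

(** Write M for the norm of f.

    Suppose |f| = M almost everywhere, g is orthogonal to f, and nevertheless
    h = a g satisfies |f + h|_oo = s < M. Then h is orthogonal to f as well.
    The point h + t f lies on the segment from h to h + f, and the modulus of
    such a point is computed exactly by the parallelogram law in the scalar
    field ([modulus_segment_sqr]):
      |h + t f|^2 = (1 - t) |h|^2 + t |h + f|^2 - t (1 - t) |f|^2.
    Because |f| is the constant M, the negative term is bounded away from zero
    uniformly in x, and choosing 1 - t = (s / M)^2 makes it cancel the middle
    one, whence |h + t f|_oo <= (s / M) |h|_oo < |h|_oo. This contradicts the
    orthogonality of h to f ([constant_modulus_right_symmetric]).

    Conversely, if |f| is not almost everywhere M, some set A = {|f| <= s} with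
    s < M is not null ([non_null_sublevel]). Let u be f on A, replaced by 1
    where f vanishes, let n > 0 be its essential supremum, and let g be u on A
    and - (n / M) f off A. Both pieces of g have essential supremum n. Adding
    a f to g cannot lower the first one when Re a >= 0, nor the second one when
    Re a <= 0 ([modulus_half_plane]), so g is orthogonal to f. But f + t g for
    a small t > 0 is smaller than f off A, where f is large, and grows only a
    little on A, where f has room below M; so f is not orthogonal to g
    ([right_symmetric_sublevel_null]). *)

(** * Moduli of scalars *)

Section scalar_modulus.
Context (R : realType) (k : scalar_kind).
Implicit Types (z w : scalars R k) (r t : R).

Lemma modulus_real_scalar r : modulus (real_scalar k r) = `|r|.
Proof. by case: k => //=; rewrite expr0n addr0 sqrtr_sqr. Qed.

Lemma real_scalar1 : real_scalar k (1 : R) = 1.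
Proof. by case: k. Qed.

Lemma modulus1 : modulus (1 : scalars R k) = 1.
Proof. by rewrite -real_scalar1 modulus_real_scalar normr1. Qed.

(** Stewart's theorem for the point dividing the segment from [w] to [w + z] in
    the ratio [t : 1 - t]; in one variable or two, it is the parallelogram law
    of the modulus. *)
Lemma modulus_segment_sqr w z t :
  modulus (w + real_scalar k t * z) ^+ 2 =
  (1 - t) * modulus w ^+ 2 + t * modulus (w + z) ^+ 2
  - t * (1 - t) * modulus z ^+ 2.
Proof.
case: k w z => /= [w z|[a b] [c d]].
  by rewrite !real_normK ?num_real//; ring.
rewrite !sqr_sqrtr ?addr_ge0 ?sqr_ge0//=; ring.
Qed.

(** Moving a point [r >= 0] by [z] does not lower its modulus when Re z >= 0, and
    the same holds for [- r] when Re z <= 0. Which alternative occurs depends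
    on [z] alone, so that it can be chosen before the point of the measure
    space. *)
Lemma modulus_half_plane z :
  (forall r, 0 <= r -> r <= modulus (real_scalar k r + z)) \/
  (forall r, 0 <= r -> r <= modulus (real_scalar k (- r) + z)).
Proof.
suff re_le (a b r : R) : 0 <= r -> 0 <= a -> r <= Num.sqrt ((r + a) ^+ 2 + b ^+ 2).
  case: k z => /= [a|[a b]].
    have [a0|a0] := leP 0 a; [left|right] => r r0.
      by rewrite (le_trans _ (ler_norm _))// lerDl.
    by rewrite ltr0_norm ?ler_wnDr//; lra.
  have [a0|a0] := leP 0 a; [left|right] => r r0 /=; rewrite add0r ?oppr0 ?add0r.
    exact: re_le.
  have -> : - r + a = - (r + - a) by ring.
  by rewrite sqrrN re_le// oppr_ge0 ltW.
move=> r0 a0; rewrite -{1}(ger0_norm r0) -sqrtr_sqr ler_wsqrtr//.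
nra.
Qed.

End scalar_modulus.

(** * Bounded functions and their norm *)

Section sup_norm.
Context (R : realType) (k : scalar_kind) (d : measure_display)
  (X : measurableType d) (mu : {measure set X -> \bar R}).
Implicit Types (f g : Linfty k mu) (c s : R).

(** The norm of [f] takes its values in the scalar field; its real counterpart
    can be compared with moduli in the ordered field [R]. *)
Definition sup_norm f : R := fine (ess_norm f).

Lemma normE f : `|f| = real_scalar k (sup_norm f).
Proof. by []. Qed.

Lemma sup_norm_ge0 f : 0 <= sup_norm f.
Proof. exact/fine_ge0/ess_norm_ge0. Qed.

Lemma ae_le_sup_norm f : \forall x \ae mu, modulus (f x) <= sup_norm f.
Proof. exact: (ae_le_ess_norm (LinftyP f)). Qed.

Lemma sup_norm_le f c :
  0 <= c -> (\forall x \ae mu, modulus (f x) <= c) -> sup_norm f <= c.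
Proof. by move=> c0 /(ess_norm_le c0)[]. Qed.

Lemma LinftyDZ f g (a : scalars R k) :
  \forall x \ae mu, (f + a *: g) x = f x + a * g x.
Proof.
near=> x; transitivity ((val f + a *: val g : Lzero k mu) x); first by [].
rewrite (near (LzeroD (val f) (a *: val g)) x)//.
by rewrite (near (LzeroZ a (val g)) x).
Unshelve. all: by end_near. Qed.

Lemma Linfty_of_bounded (h : X -> scalars R k) c : 0 <= c ->
  measurable_fun setT (h : X -> borel_scalars R k) ->
  (\forall x \ae mu, modulus (h x) <= c) ->
  exists g, \forall x \ae mu, g x = h x.
Proof.
move=> c0 mh hc; pose H := Lzero_class mu mh.
have HE : \forall x \ae mu, H x = h x by exact: Lzero_classE.
have Hb : H \in @essentially_bounded R k d X mu.
  apply: (ess_norm_le c0 _).1; near=> x.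
  by rewrite (near HE x)//; near: x.
by exists (MkLinfty Hb).
Unshelve. all: by end_near. Qed.

Lemma open_modulus_gt s : open [set z : scalars R k | s < modulus z].
Proof.
rewrite openE => z /= sz; rewrite /interior -nbhs_ballE.
exists (`|z| - real_scalar k s) => /=.
  rewrite subr_gt0 -modulusE lt_neqAle ler_real_scalar (ltW sz) andbT.
  by apply: contraTneq sz => /real_scalar_inj ->; rewrite ltxx.
move=> w; rewrite -ball_normE /= => zw.
have : real_scalar k s < real_scalar k (modulus w).
  rewrite modulusE; move: zw; rewrite ltrBrDl -ltrBrDr => /lt_le_trans; apply.
  by rewrite lerBlDr (le_trans _ (ler_normD _ _))// addrC subrK.
by rewrite lt_neqAle ler_real_scalar => /andP[sw]; rewrite lt_neqAle => ->;
  rewrite andbT; apply: contraNneq sw => ->.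
Qed.

Lemma measurable_modulus_le f s :
  measurable_fun [set: X] (fun x => modulus (f x) <= s).
Proof.
apply: (measurable_fun_bool false); rewrite setTI.
have /measurable_scalarP/(_ _ (@open_modulus_gt s)) := measurable_Lzero f.
by congr measurable; apply/seteqP; split=> x /=; rewrite ltNge; [move/negbTE|move=> ->].
Qed.

End sup_norm.

(** * Right-symmetric functions *)

Section right_symmetry.
Context (R : realType) (k : scalar_kind) (d : measure_display)
  (X : measurableType d) (mu : {measure set X -> \bar R}).
Implicit Types (f g : Linfty k mu) (s : R).

(** Scaling out [a]: |a g + b f| = |a| |g + (b / a) f|. *)
Lemma BJ_orthogonalZl f g (a : scalars R k) :
  BJ_orthogonal g f -> BJ_orthogonal (a *: g) f.
Proof.
have [->|a0] := eqVneq a 0; first by move=> _ b; rewrite scale0r normr0.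
move=> gf b; have -> : a *: g + b *: f = a *: (g + (a^-1 * b) *: f).
  by rewrite scalerDr scalerA mulVKf.
by rewrite !normrZ ler_wpM2l.
Qed.

Lemma sup_norm_BJ f g (a : scalars R k) :
  BJ_orthogonal f g -> sup_norm f <= sup_norm (f + a *: g).
Proof. by move=> /(_ a); rewrite !normE ler_real_scalar. Qed.

(** The strict inequality |h + t f| < |h| on norms has to come from a bound that
    is uniform in [x]; constancy of |f| is what provides it. *)
Lemma constant_modulus_right_symmetric f :
  (\forall x \ae mu, modulus (f x) = sup_norm f) -> right_symmetric f.
Proof.
move=> fM g gf a; rewrite !normE ler_real_scalar leNgt; apply/negP.
have {gf} := BJ_orthogonalZl a gf; set h := a *: g => hf.
set s := sup_norm (f + h); set M := sup_norm f in fM *; set N := sup_norm h.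
move=> sM; have s0 : 0 <= s := sup_norm_ge0 _.
have M0 : 0 < M by exact: le_lt_trans sM.
have N0 : 0 < N.
  rewrite lt_neqAle sup_norm_ge0 andbT; apply/eqP => N0.
  have h0 : h = 0 by apply/normr0_eq0; rewrite normE -/N -N0 real_scalar0.
  by move: sM; rewrite /s h0 addr0 ltxx.
(* With 1 - t = r ^ 2 and s = r M, the terms t s ^ 2 and t (1 - t) M ^ 2 of
   Stewart's identity are equal. *)
pose r := s / M; pose t := 1 - r ^+ 2.
have r0 : 0 <= r by rewrite divr_ge0 ?(ltW M0).
have r1 : r < 1 by rewrite ltr_pdivrMr// mul1r.
have t0 : 0 <= t by rewrite subr_ge0 expr_le1// ltW.
have rM : r * M = s by rewrite divfK// gt_eqF.
have : N <= r * N.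
  rewrite (le_trans (sup_norm_BJ (real_scalar k t) hf))//.
  apply: sup_norm_le; first exact: mulr_ge0 r0 (ltW N0).
  near=> x.
  have -> : (h + real_scalar k t *: f) x = h x + real_scalar k t * f x.
    by near: x; exact: LinftyDZ.
  rewrite -(@ler_pXn2r _ 2)// ?nnegrE ?modulus_ge0 ?(mulr_ge0 r0 (ltW N0))//.
  rewrite modulus_segment_sqr.
  have -> : modulus (f x) = M by near: x.
  have hN : modulus (h x) ^+ 2 <= N ^+ 2.
    rewrite ler_pXn2r ?nnegrE ?modulus_ge0 ?(ltW N0)//.
    by near: x; exact: ae_le_sup_norm.
  have fhs : modulus (h x + f x) ^+ 2 <= s ^+ 2.
    rewrite ler_pXn2r ?nnegrE ?modulus_ge0//.
    have <- : (f + h) x = h x + f x.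
      by near: x; have := LinftyDZ f h 1; rewrite scale1r; apply: filterS => x ->;
        rewrite mul1r addrC.
    by near: x; exact: ae_le_sup_norm.
  have -> : (r * N) ^+ 2 = r ^+ 2 * N ^+ 2 + t * s ^+ 2 - t * r ^+ 2 * M ^+ 2.
    by rewrite -rM; ring.
  rewrite /t subKr lerB// lerD// ler_wpM2l ?sqr_ge0//.
by apply/negP; rewrite -ltNge gtr_pMl.
Unshelve. all: by end_near. Qed.

(** The set where |f| < M is a countable union of sublevel sets, so it can only
    fail to be null if one of them does. *)
Lemma non_null_sublevel f : ~ (\forall x \ae mu, modulus (f x) = sup_norm f) ->
  exists2 s, s < sup_norm f & ~ (\forall x \ae mu, s < modulus (f x)).
Proof.
move=> fM; apply: contrapT => noS; apply: fM.
have H : \forall x \ae mu, forall n, sup_norm f - n.+1%:R^-1 < modulus (f x).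
  apply: ae_foralln => n; apply: contrapT => nS; apply: noS.
  by exists (sup_norm f - n.+1%:R^-1) => //; rewrite ltrBlDr ltrDl invr_gt0.
near=> x; apply/eqP; rewrite eq_le; apply/andP; split.
  by near: x; exact: ae_le_sup_norm.
rewrite leNgt; apply/negP => /ltr_add_invr[n].
have /(_ n) : forall n, sup_norm f - n.+1%:R^-1 < modulus (f x) by near: x.
by rewrite ltrBlDr => /lt_trans /[apply]; rewrite ltxx.
Unshelve. all: by end_near. Qed.

(** Right-symmetry is refuted on a non-null sublevel set A = {|f| <= s} by the
    function [g] equal to [u] on A and to [- (n / M) f] off A. The lower bound
    on |g + a f| holds because the supremum [n] of |g| is approached both on A,
    by definition of [n], and off A, because |f| <= s < M on A forces the
    supremum M of |f| to be approached off A. *)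
Lemma right_symmetric_sublevel_null f s :
  right_symmetric f -> s < sup_norm f -> \forall x \ae mu, s < modulus (f x).
Proof.
move=> fsym sM; apply: contrapT => nS; set M := sup_norm f in sM.
have s0 : 0 <= s.
  rewrite leNgt; apply/negP => s0; apply: nS.
  by apply: nearW => x; rewrite (lt_le_trans s0)// modulus_ge0.
have M0 : 0 < M by exact: le_lt_trans sM.
(* The value 1 on the zero set of f keeps u nonzero everywhere; as A is not null,
   n > 0 even if f vanishes almost everywhere on A. *)
pose u x : scalars R k := if modulus (f x) <= 0 then 1 else f x.
have uP x : modulus (f x) <= s -> modulus (u x) <= 1 + s.
  by rewrite /u; case: ifP => _ fs; rewrite ?modulus1; lra.
have mu_u : measurable_fun setT (u : X -> borel_scalars R k).
  apply: measurable_fun_ifT; first exact: measurable_modulus_le.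
    exact: (@measurable_scalar_cst R k d X 1).
  exact: measurable_Lzero.
have [v vE] : exists v : Linfty k mu, \forall x \ae mu,
    v x = if modulus (f x) <= s then u x else 0.
  apply: (@Linfty_of_bounded R k d X mu _ (1 + s)); first lra.
    apply: measurable_fun_ifT => //; first exact: measurable_modulus_le.
  apply: nearW => x; case: ifPn => [/uP//|_]; rewrite modulus0; lra.
pose n := sup_norm v.
have un : \forall x \ae mu, modulus (f x) <= s -> modulus (u x) <= n.
  near=> x => fs; have -> : u x = v x.
    by have -> : v x = if modulus (f x) <= s then u x else 0 by [near: x];
      rewrite fs.
  by near: x; exact: ae_le_sup_norm.
have n0 : 0 < n.
  rewrite lt_neqAle sup_norm_ge0 andbT; apply/eqP => n0; apply: nS.
  apply: filterS un => x; rewrite -n0 ltNge => ux; apply/negP => /ux.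
  rewrite /u; case: ifPn; last by move=> /negP.
  by rewrite modulus1 ler10.
have bound_B : \forall x \ae mu, modulus (real_scalar k (- (n / M)) * f x) <= n.
  apply: filterS (ae_le_sup_norm f) => x fM.
  rewrite modulusM modulus_real_scalar normrN gtr0_norm ?divr_gt0//.
  by rewrite mulrAC ler_pdivrMr// ler_wpM2l ?(ltW n0).
have [g gE] : exists g : Linfty k mu, \forall x \ae mu,
    g x = if modulus (f x) <= s then u x else real_scalar k (- (n / M)) * f x.
  apply: (@Linfty_of_bounded R k d X mu _ n); first exact: ltW.
    apply: measurable_fun_ifT => //; first exact: measurable_modulus_le.
    by apply: measurable_scalarM; exact: measurable_Lzero.
  by near=> x; case: ifPn => [|_]; near: x.
have gA : \forall x \ae mu, modulus (f x) <= s -> g x = u x.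
  by apply: filterS gE => x -> ->.
have gB : \forall x \ae mu,
    s < modulus (f x) -> g x = real_scalar k (- (n / M)) * f x.
  by apply: filterS gE => x -> fs; rewrite leNgt fs.
have g_le : \forall x \ae mu, modulus (g x) <= n.
  near=> x; have [fs|fs] := leP (modulus (f x)) s.
    have -> : g x = u x by move: fs; near: x.
    by move: fs; near: x.
  have -> : g x = real_scalar k (- (n / M)) * f x by move: fs; near: x.
  by near: x.
have gf : BJ_orthogonal g f.
  move=> a; rewrite !normE ler_real_scalar; set c := sup_norm (g + a *: f).
  have c0 : 0 <= c := sup_norm_ge0 _.
  have cE : \forall x \ae mu, modulus (g x + a * f x) <= c.
    near=> x; have <- : (g + a *: f) x = g x + a * f x.
      by near: x; exact: LinftyDZ.
    by near: x; exact: ae_le_sup_norm.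
  apply: (@le_trans _ _ n); first exact: sup_norm_le (ltW n0) g_le.
  have [aP|aN] := modulus_half_plane a.
    apply: sup_norm_le => //; near=> x.
    have -> : v x = if modulus (f x) <= s then u x else 0 by near: x.
    case: ifPn => fs; last by rewrite modulus0.
    apply: (@le_trans _ _ (modulus (g x + a * f x))); last by near: x.
    have -> : g x = u x by move: fs; near: x.
    rewrite /u; case: ifPn => [f0|_].
      have -> : f x = 0 by apply/modulus_eq0/eqP; rewrite eq_le f0 modulus_ge0.
      by rewrite mulr0 addr0.
    rewrite -{2}[f x]mul1r -mulrDl modulusM ler_peMl ?modulus_ge0//.
    by have := aP 1 ler01; rewrite real_scalar1.
  (* If c < n, then off A the bound on |g + a f| gives |f| <= c M / n < M, and on
     A there is |f| <= s < M. *)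
  rewrite leNgt; apply/negP => cn.
  suff : M <= Num.max s (c * M / n).
    rewrite leNgt gt_max sM ltr_pdivrMr// [ltRHS]mulrC ltr_pM2r//.
    by rewrite cn.
  apply: sup_norm_le; first by rewrite le_max s0.
  near=> x; rewrite le_max; case: (leP (modulus (f x)) s) => //= fs.
  have nM0 : 0 < n / M by rewrite divr_gt0.
  have -> : c * M / n = c / (n / M) by rewrite invf_div mulrA.
  rewrite ler_pdivlMr// mulrC.
  apply: (@le_trans _ _ (modulus (g x + a * f x))); last by near: x.
  have -> : g x = real_scalar k (- (n / M)) * f x by move: fs; near: x.
  by rewrite -mulrDl modulusM ler_wpM2r ?modulus_ge0// aN// ltW.
(* This t makes the bound s + t n on A equal to the bound M - t n off A. *)
pose t := (M - s) / (2 * n).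
have t0 : 0 < t by rewrite divr_gt0 ?mulr_gt0// subr_gt0.
have tn : t * n = (M - s) / 2 by rewrite /t; field; rewrite gt_eqF.
have : M <= (M + s) / 2.
  rewrite (le_trans (sup_norm_BJ (real_scalar k t) (fsym _ gf)))//.
  apply: sup_norm_le; first lra.
  near=> x.
  have -> : (f + real_scalar k t *: g) x = f x + real_scalar k t * g x.
    by near: x; exact: LinftyDZ.
  have [fs|fs] := leP (modulus (f x)) s.
    have -> : g x = u x by move: fs; near: x.
    rewrite (le_trans (modulusD _ _))// modulusM modulus_real_scalar gtr0_norm//.
    have : t * modulus (u x) <= t * n by rewrite ler_pM2l//; move: fs; near: x.
    lra.
  have -> : g x = real_scalar k (- (n / M)) * f x by move: fs; near: x.
  have -> : f x + real_scalar k t * (real_scalar k (- (n / M)) * f x) =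
      real_scalar k (1 - (M - s) / 2 / M) * f x.
    rewrite mulrA -real_scalarM -tn mulrN -[t * n / M]mulrA real_scalarD mulrDl.
    by rewrite real_scalar1 mul1r.
  have q1 : 0 <= 1 - (M - s) / 2 / M by rewrite subr_ge0 ler_pdivrMr//; lra.
  rewrite modulusM modulus_real_scalar ger0_norm//.
  have -> : (M + s) / 2 = (1 - (M - s) / 2 / M) * M by field; rewrite gt_eqF.
  by rewrite ler_wpM2l//; near: x; exact: ae_le_sup_norm.
by lra.
Unshelve. all: by end_near. Qed.

End right_symmetry.

Theorem theorem2p3p2 (R : realType) (k : scalar_kind) (d : measure_display)
    (X : measurableType d) (lambda : {measure set X -> \bar R})
    (f : Linfty k lambda) :
  right_symmetric f <-> {ae lambda, forall x : X, `|f x| = `|f|}.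
Proof.
have ae_normE : {ae lambda, forall x : X, `|f x| = `|f|} <->
    \forall x \ae lambda, modulus (f x) = sup_norm f.
  split; apply: filterS => x; rewrite normE -modulusE; last by move=> ->.
  exact: real_scalar_inj.
rewrite ae_normE; split; last exact: constant_modulus_right_symmetric.
move=> fsym; apply: contrapT => /non_null_sublevel[s sM]; apply.
exact: right_symmetric_sublevel_null.
Qed.
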